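(* Let $\mathcal S=(\mathcal U,\tilde\varphi,(\iota^{(i)})_{i\ge1})$ be a spreadability system for a $\mathcal B$-valued noncommutative probability space $(\mathcal A,\varphi)$, with partitioned cumulants $K_\pi$. For all $n\in\mathbb N$, $\pi\in\mathcal{OP}_n$, $X_1,\dots,X_n\in\mathcal A$ and $N\in\mathbb N$ the cumulants satisfy extensivity, $$K_\pi(N.X_1,\dots,N.X_n)=N^{|\pi|}K_\pi(X_1,\dots,X_n),$$ and more generally, for $N_1,\dots,N_{|\pi|}\in\mathbb N$, $$K_\pi(N_{\pi(1)}.X_1,N_{\pi(2)}.X_2,\dots,N_{\pi(n)}.X_n)=N_1N_2\cdots N_{|\pi|}\,K_\pi(X_1,\dots,X_n).$$
   Context: Ordered set partitions. $\mathbb N=\{1,2,\dots\}$, $[n]=\{1,\dots,n\}$. An ordered set partition of $[n]$ is a sequence $\pi=(P_1,\dots,P_p)$ of pairwise disjoint nonempty blocks with union $[n]$; $|\pi|=p$; $\mathcal{OP}_n$ is the set of them; $\pi(i)$ denotes the index $k$ with $i\in P_k$; $\bar\pi$ is the underlying set partition; set partitions are ordered by refinement. For $\pi=(P_1,\dots,P_p)$, $\sigma=(S_1,\dots,S_s)$ we write $\pi\le\sigma$ iff $\bar\pi\le\bar\sigma$ and, whenever $i<j$, $P_i\subseteq S_k$, $P_j\subseteq S_l$, one has $k\le l$. The quasi-meet is $\pi\curlywedge\sigma=(P_1\cap S_1,P_1\cap S_2,\dots,P_1\cap S_s,P_2\cap S_1,\dots,P_p\cap S_s)$ with empty sets removed.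 The ordered kernel $\kappa(i_1,\dots,i_n)\in\mathcal{OP}_n$ has as blocks the level sets $\{k:i_k=v\}$ listed in increasing order of $v$. For $\sigma\le\pi$, $\widetilde\mu(\sigma,\pi)=(-1)^{|\sigma|-|\pi|}/\prod_{P\in\pi}\#(\sigma\rfloor_P)$, where $\#(\sigma\rfloor_P)$ is the number of blocks of $\sigma$ contained in the block $P$ of $\pi$. Spreadability systems. Algebras are associative over $\mathbb C$. A $\mathcal B$-valued noncommutative probability space is an algebra $\mathcal A$ with a linear map $\varphi:\mathcal A\to\mathcal B$ into an algebra $\mathcal B$. A spreadability system for it is a triple $(\mathcal U,\tilde\varphi,(\iota^{(i)})_{i\ge1})$ with $\mathcal U$ an algebra, $\tilde\varphi:\mathcal U\to\mathcal B$ linear, $\iota^{(i)}:\mathcal A\to\mathcal U$ homomorphisms with $\varphi=\tilde\varphi\circ\iota^{(i)}$, such that, writing $X^{(i)}=\iota^{(i)}(X)$, $\tilde\varphi(X_1^{(i_1)}\cdots X_n^{(i_n)})=\tilde\varphi(X_1^{(h(i_1))}\cdots X_n^{(h(i_n))})$ for all $X_k\in\mathcal A$, $i_k\in\mathbb N$ and all $h:\{i_1,\dots,i_n\}\to\mathbb N$ with $i_p<i_q\Rightarrow h(i_p)<h(i_q)$. For $\pi\in\mathcal{OP}_n$, $\varphi_\pi(X_1,\dots,X_n):=\tilde\varphi(X_1^{(i_1)}\cdots X_n^{(i_n)})$ for any indices with $\kappa(i_1,\dots,i_n)=\pi$; one extends $\varphi_\pi(X_1^{(i_1)},\dots,X_n^{(i_n)}):=\varphi_{\pi\curlywedge\kappa(i_1,\dots,i_n)}(X_1,\dots,X_n)$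 and $\varphi_\pi(M_1.X_1,\dots,M_n.X_n):=\sum_{i_1=1}^{M_1}\cdots\sum_{i_n=1}^{M_n}\varphi_\pi(X_1^{(i_1)},\dots,X_n^{(i_n)})$ for $M_k\in\mathbb N$. Cumulants. For $\pi\in\mathcal{OP}_n$ with $p$ blocks, $K_\pi(X_1,\dots,X_n)$ is the coefficient of $N_1\cdots N_p$ in the polynomial (in $N_1,\dots,N_p$, with coefficients in $\mathcal B$) $\varphi_\pi(N_{\pi(1)}.X_1,\dots,N_{\pi(n)}.X_n)$. Equivalently $K_\pi=\sum_{\sigma\le\pi}\widetilde\mu(\sigma,\pi)\varphi_\sigma$, and this formula extends cumulants to dotted arguments: $K_\pi(M_1.X_1,\dots,M_n.X_n):=\sum_{\sigma\le\pi}\widetilde\mu(\sigma,\pi)\,\varphi_\sigma(M_1.X_1,\dots,M_n.X_n)$. *)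

(* Defs.v *)
From HB Require Import structures.
From mathcomp Require Import all_boot all_order all_algebra.
From mathcomp Require Import reals.
From mathcomp Require classical_sets.
From mathcomp.real_closed Require Import complex.

Set Implicit Arguments.
Unset Strict Implicit.
Unset Printing Implicit Defensive.

Import Order.TTheory GRing.Theory Num.Theory.
Local Open Scope ring_scope.

(* Associative algebras that need not have a unit: the embeddings of a
   spreadability system are in general not unital (e.g. in Boolean or monotone
   independence), and [algType] would moreover exclude the zero algebra. *)
HB.mixin Record Lmodule_isAssocAlgebra (K : pzRingType) V
    of GRing.Lmodule K V := {
  amul : V -> V -> V;
  amulA : associative amul;
  amulDl : left_distributive amul +%R;
  amulDr : right_distributive amul +%R;
  amulZl : forall (c : K) (x y : V), amul (c *: x) y = c *: amul x y;
  amulZr : forall (c : K) (x y : V), amul x (c *: y) = c *: amul x y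
}.

#[short(type="assocAlgType")]
HB.structure Definition AssocAlgebra (K : pzRingType) :=
  {V of Lmodule_isAssocAlgebra K V & GRing.Lmodule K V}.

(* The value 0 on the empty sequence is never used: there is no empty product
   in an algebra without unit, and products below have at least one factor. *)
Definition aprod (K : pzRingType) (U : assocAlgType K) (s : seq U) : U :=
  if s is x :: s' then foldl amul x s' else 0.

Definition is_alg_hom (K : pzRingType) (A U : assocAlgType K) (f : A -> U) :=
  linear f /\ {morph f : x y / amul x y}.

(* [n] is represented by 'I_n, so k : 'I_n stands for k + 1; likewise the
   blocks P_1, ..., P_p of an ordered set partition are indexed by 'I_p. *)
Section OrderedSetPartitions.
Variable n : nat.

Definition is_osp (s : seq {set 'I_n}) : bool :=
  [&& set0 \notin s, pairwise (fun P Q : {set 'I_n} => [disjoint P & Q]) s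
    & \bigcup_(P <- s) P == [set: 'I_n]].

(* The bound n on the number of blocks is automatic (see [size_is_osp]); it
   only serves to make [osp] a finite type. *)
Record osp := OSP { blocks :> n.-bseq {set 'I_n}; _ : is_osp blocks }.

HB.instance Definition _ := [isSub for blocks].
HB.instance Definition _ := [Finite of osp by <:].

Lemma ospP (pi : osp) : is_osp pi. Proof. exact: valP pi. Qed.

Lemma size_is_osp s : is_osp s -> (size s <= n)%N.
Proof.
case/and3P=> s0 sd _.
suff H : (size s <= #|\bigcup_(P <- s) P|)%N.
  by apply: leq_trans H _; rewrite -[X in (_ <= X)%N]card_ord; apply: max_card.
elim: s s0 sd => [|P s IH] //=; rewrite inE negb_or => /andP[P0 s0].
case/andP=> Ps sd; rewrite big_cons.
have dPs : P :&: \bigcup_(Q <- s) Q = set0.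
  apply/setP=> x; rewrite !inE; apply/negP=> /andP[xP].
  rewrite bigcup_seq => /bigcupP[Q Qs xQ].
  have := allP Ps _ Qs; rewrite -setI_eq0 => /eqP/setP/(_ x).
  by rewrite !inE xP xQ.
rewrite cardsU dPs cards0 subn0 -add1n leq_add ?IH //.
by rewrite card_gt0 eq_sym.
Qed.

Definition osp_of (s : seq {set 'I_n}) (sP : is_osp s) : osp :=
  @OSP (Bseq (size_is_osp sP)) sP.

Lemma osp_inj (pi sigma : osp) : pi = sigma :> seq {set 'I_n} -> pi = sigma.
Proof. by move=> e; apply/val_inj/val_inj. Qed.

Lemma is_osp_cover s k : is_osp s -> has (fun P : {set 'I_n} => k \in P) s.
Proof.
case/and3P=> _ _ /eqP/setP/(_ k); rewrite inE bigcup_seq => /bigcupP[P Ps kP].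
by apply/hasP; exists P.
Qed.

Lemma block_index_subproof (pi : osp) (k : 'I_n) :
  (find (fun P : {set 'I_n} => k \in P) pi < size pi)%N.
Proof. by rewrite -has_find is_osp_cover ?ospP. Qed.

(* pi(k), with values in 'I_|pi| *)
Definition block_index (pi : osp) (k : 'I_n) : 'I_(size pi) :=
  Ordinal (block_index_subproof pi k).

(* refinement order on the underlying unordered set partitions *)
Definition refines (sigma pi : osp) : bool :=
  [forall Q in [set Q in sigma : seq _],
     exists P in [set P in pi : seq _], Q \subset P].

Definition osp_le (pi sigma : osp) : bool :=
  refines pi sigma &&
  [forall i : 'I_(size pi), forall j : 'I_(size pi),
   forall k : 'I_(size sigma), forall l : 'I_(size sigma),
     [&& (i < j)%N, nth set0 pi i \subset nth set0 sigma k
       & nth set0 pi j \subset nth set0 sigma l] ==> (k <= l)%N].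

Definition qmeet_seq (pi sigma : seq {set 'I_n}) : seq {set 'I_n} :=
  [seq B <- [seq P :&: Q | P <- pi, Q <- sigma] | B != set0].

Lemma is_ospP (s : seq {set 'I_n}) :
  reflect [/\ set0 \notin s, forall k, exists2 P, P \in s & k \in P &
     forall k i j, (i < j < size s)%N -> k \in nth set0 s i ->
       k \in nth set0 s j -> False] (is_osp s).
Proof.
apply: (iffP and3P) => [[s0 sd sc]|[s0 sc sd]]; split=> //.
- by move=> k; apply/hasP/is_osp_cover/and3P.
- move=> k i j /andP[ij js] ki kj.
  have /(pairwiseP set0)/(_ i j) := sd.
  rewrite !inE js (ltn_trans ij js) => /(_ isT isT ij).
  by rewrite -setI_eq0 => /eqP/setP/(_ k); rewrite !inE ki kj.
- apply/(pairwiseP set0) => i j; rewrite !inE => si js ij.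
  rewrite -setI_eq0; apply/eqP/setP=> k; rewrite !inE; apply/negP=> /andP[ki kj].
  by apply: (sd k i j) => //; rewrite ij.
- apply/eqP/setP=> k; rewrite inE bigcup_seq.
  by have [P Ps kP] := sc k; apply/bigcupP; exists P.
Qed.

Lemma is_osp_qmeet (pi sigma : osp) : is_osp (qmeet_seq pi sigma).
Proof.
apply/and3P; split.
- by rewrite mem_filter eqxx.
- rewrite /qmeet_seq; apply: pairwise_filter.
  have /and3P[_ pd _] := ospP pi; have /and3P[_ sd _] := ospP sigma.
  elim: (pi : seq _) pd => //= P s IH /andP[Ps /IH{}IH].
  rewrite pairwise_cat IH andbT; apply/andP; split.
    apply/allrelP=> _ _ /mapP[Q0 _ ->] /allpairsP[[Q T] /= [Qs _ ->]].
    have := allP Ps _ Qs; rewrite -!setI_eq0 => /eqP PQ.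
    by rewrite setIACA PQ set0I.
  rewrite pairwise_map; apply: sub_pairwise sd => Q T /=.
  by rewrite -!setI_eq0 setIACA => /eqP ->; rewrite setI0.
- apply/eqP/setP=> k; rewrite inE bigcup_seq.
  have /hasP[P Ps kP] := is_osp_cover k (ospP pi).
  have /hasP[Q Qs kQ] := is_osp_cover k (ospP sigma).
  apply/bigcupP; exists (P :&: Q); last by rewrite inE kP.
  rewrite mem_filter; apply/andP; split; last by apply/allpairsP; exists (P, Q).
  by apply/set0Pn; exists k; rewrite inE kP.
Qed.

Definition qmeet (pi sigma : osp) : osp := osp_of (is_osp_qmeet pi sigma).

Definition okernel_seq (i : 'I_n -> nat) : seq {set 'I_n} :=
  [seq [set k | i k == v] | v <- sort leq (undup (codom i))].

Lemma is_osp_okernel i : is_osp (okernel_seq i).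
Proof.
apply/and3P; split.
- apply/negP=> /mapP[v]; rewrite mem_sort mem_undup => /codomP[k ->].
  by move/setP/(_ k); rewrite !inE eqxx.
- rewrite pairwise_map.
  have : uniq (sort leq (undup (codom i))) by rewrite sort_uniq undup_uniq.
  rewrite uniq_pairwise; apply: sub_pairwise => u v /= uv.
  rewrite -setI_eq0; apply/eqP/setP=> k; rewrite !inE; apply/negP.
  by case/andP=> /eqP-> /eqP vu; rewrite vu eqxx in uv.
- apply/eqP/setP=> k; rewrite inE bigcup_seq; apply/bigcupP.
  exists [set l | i l == i k]; last by rewrite inE.
  by apply/map_f; rewrite mem_sort mem_undup codom_f.
Qed.

Definition okernel (i : 'I_n -> nat) : osp := osp_of (is_osp_okernel i).

Lemma block_index_okernel (i : 'I_n -> nat) k :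
  block_index (okernel i) k = index (i k) (sort leq (undup (codom i))) :> nat.
Proof.
rewrite /= /okernel_seq find_map /index; apply: eq_find => v /=.
by rewrite inE eq_sym.
Qed.

Lemma block_indexE (pi : osp) k j : (j < size pi)%N ->
  (block_index pi k == j :> nat) = (k \in nth set0 pi j).
Proof.
move=> jp; have kb := nth_find set0 (is_osp_cover k (ospP pi)).
rewrite /= in kb *; apply/eqP/idP => [<- //|kj].
have fp := block_index_subproof pi k; have /is_ospP[_ _ pd] := ospP pi.
case: (ltngtP (find (fun P : {set 'I_n} => k \in P) pi) j) => // lt.
- by case: (pd k _ j _ kb kj); rewrite lt.
- by case: (pd k j _ _ kj kb); rewrite lt.
Qed.

Lemma okernel_block_index (pi : osp) :
  okernel (fun k => (block_index pi k).+1) = pi.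
Proof.
apply: osp_inj; rewrite /= /okernel_seq.
have -> : sort leq (undup (codom (fun k => (block_index pi k).+1))) =
          iota 1 (size pi).
  apply: (sorted_eq leq_trans anti_leq); first exact: (sort_sorted leq_total).
    exact: iota_sorted.
  rewrite perm_sort; apply: uniq_perm; rewrite ?undup_uniq ?iota_uniq // => v.
  rewrite mem_undup mem_iota add1n ltnS; apply/codomP/idP.
    by case=> k ->; apply: block_index_subproof.
  case: v => // j /= jp.
  have /is_ospP[p0 _ _] := ospP pi.
  have /set0Pn[k kj] : nth set0 pi j != set0.
    by apply: contraNneq p0 => <-; apply: mem_nth.
  by exists k; congr _.+1; apply/esym/eqP; rewrite block_indexE.
apply: (@eq_from_nth _ set0); first by rewrite size_map size_iota.
move=> j; rewrite size_map size_iota => jp.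
rewrite (nth_map 0%N) ?size_iota // nth_iota // add1n.
by apply/setP=> k; rewrite inE eqSS block_indexE.
Qed.

(* #(sigma restricted to P) *)
Definition nblocks_in (sigma : osp) (P : {set 'I_n}) : nat :=
  count (fun Q : {set 'I_n} => Q \subset P) sigma.

(* Only meant for sigma <= pi, so that the subtraction does not truncate. *)
Definition mu_tilde (K : fieldType) (sigma pi : osp) : K :=
  (-1) ^+ (size sigma - size pi) / \prod_(P <- pi) (nblocks_in sigma P)%:R.

End OrderedSetPartitions.

(* iota_ i is only constrained, and only used, for i >= 1; the map h on
   {i_1, ..., i_n} is given as the restriction of a map on nat. *)
Record spreadability_system (K : fieldType) (A B : assocAlgType K)
    (phi : {linear A -> B}) := SpreadabilitySystem {
  sp_alg : assocAlgType K;
  sp_phi : {linear sp_alg -> B};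
  iota_ : nat -> A -> sp_alg;
  iota_hom : forall i, (0 < i)%N -> is_alg_hom (iota_ i);
  iota_phi : forall i, (0 < i)%N -> phi =1 sp_phi \o iota_ i;
  spreadable : forall (n : nat) (X : 'I_n -> A) (i : 'I_n -> nat)
      (h : nat -> nat),
    (0 < n)%N -> (forall k, 0 < i k)%N -> (forall k, 0 < h (i k))%N ->
    (forall p q, (i p < i q)%N -> (h (i p) < h (i q))%N) ->
    sp_phi (aprod [seq iota_ (i k) (X k) | k <- enum 'I_n]) =
    sp_phi (aprod [seq iota_ (h (i k)) (X k) | k <- enum 'I_n])
}.

Section Cumulants.
Variables (K : fieldType) (A B : assocAlgType K) (phi : {linear A -> B}).
Variables (S : spreadability_system phi) (n : nat).
Implicit Types (pi sigma : osp n) (X : 'I_n -> A).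

(* phi~ (X_1^(i_1) ... X_n^(i_n)) *)
Definition phi_word (i : 'I_n -> nat) X : B :=
  sp_phi S (aprod [seq iota_ S (i k) (X k) | k <- enum 'I_n]).

(* phi_pi(X_1, ..., X_n), computed with the indices i_k = pi(k); by
   [phi_partE], all indices with ordered kernel pi give the same value. *)
Definition phi_part pi X : B := phi_word (fun k => (block_index pi k).+1) X.

(* phi_pi(X_1^(i_1), ..., X_n^(i_n)) *)
Definition phi_part_idx pi (i : 'I_n -> nat) X : B :=
  phi_part (qmeet pi (okernel i)) X.

(* phi_pi(M_1.X_1, ..., M_n.X_n); the sum is over i_k = 1, ..., M_k *)
Definition phi_part_dot pi (M : 'I_n -> nat) X : B :=
  \sum_(i : {dffun forall k : 'I_n, 'I_(M k)})
     phi_part_idx pi (fun k => (i k).+1) X.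

(* C is the coefficient of N_1 ... N_p in a polynomial in N_1, ..., N_p with
   coefficients c_a in B (a ranging over exponents a_j < d + 2) whose value at
   all positive integers is phi_pi(N_pi(1).X_1, ..., N_pi(n).X_n). *)
Definition is_cumulant pi X (C : B) : Prop :=
  exists (d : nat) (c : {ffun 'I_(size pi) -> 'I_d.+2} -> B),
    (forall N : 'I_(size pi) -> nat, (forall j, 0 < N j)%N ->
       phi_part_dot pi (fun k => N (block_index pi k)) X =
       \sum_a c a *+ (\prod_j N j ^ a j)%N) /\
    C = c [ffun=> inord 1].

(* K_pi(X_1, ..., X_n) *)
Definition cumulant pi X : B := classical_sets.xget 0 (is_cumulant pi X).

(* K_pi(M_1.X_1, ..., M_n.X_n) *)
Definition cumulant_dot pi (M : 'I_n -> nat) X : B :=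
  \sum_(sigma : osp n | osp_le sigma pi)
     mu_tilde K sigma pi *: phi_part_dot sigma M X.

Lemma phi_partE pi (i : 'I_n -> nat) X :
  (0 < n)%N -> (forall k, 0 < i k)%N -> okernel i = pi ->
  phi_word i X = phi_part pi X.
Proof.
move=> n0 i0 <-; rewrite /phi_part /phi_word.
set s := sort leq (undup (codom i)).
have i_s k : i k \in s by rewrite mem_sort mem_undup codom_f.
rewrite (@spreadable _ _ _ _ S n X i (fun v => (index v s).+1)) //; last first.
  move=> p q pq; rewrite ltnS ltnNge; apply/negP=> qp.
  have := sorted_leq_nth leq_trans leqnn 0%N (sort_sorted leq_total (undup (codom i))).
  move/(_ (index (i q) s) (index (i p) s)); rewrite !inE !index_mem !i_s.
  move=> /(_ isT isT qp); rewrite !nth_index //.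
  by rewrite leqNgt pq.
by congr (sp_phi S (aprod _)); apply: eq_map => k; rewrite block_index_okernel.
Qed.

End Cumulants.

(* Main.v *)
Require Import Defs.
From HB Require Import structures.
From mathcomp Require Import all_boot all_order all_algebra.
From mathcomp Require Import zify.
From mathcomp Require Import reals.
From mathcomp.real_closed Require Import complex.

Set Implicit Arguments.
Unset Strict Implicit.
Unset Printing Implicit Defensive.

Import Order.TTheory GRing.Theory Num.Theory.
Local Open Scope ring_scope.

(** Write kappa for the ordered kernel and t_j for the number of blocks of
    tau inside the j-th block of pi.  For any function F on ordered set
    partitions,

      sum_m F(pi /\ kappa(m)) = sum_(tau <= pi) prod_j C(M_j, t_j) F(tau),

    where m ranges over the tuples with 1 <= m_k <= M_(pi(k))
    ([sum_qmeet_okernel]): the tuples m with pi /\ kappa(m) = tau are obtained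
    by choosing, for the j-th block of pi, an increasing sequence of t_j values
    among 1, ..., M_j.  The right-hand side is a polynomial in the M_j; as the
    linear coefficient of C(x, t) is (-1)^(t-1)/t, its coefficient of
    M_1 ... M_p is the sum of mu~(tau, pi) F(tau)
    ([multilinear_coef_qmeet_okernel]).

    For F = phi_tau(X) the left-hand side is phi_pi(M.X), so this coefficient
    is the cumulant K_pi(X).  For F = phi_tau(N.X), with N constant on the
    blocks of pi, it is K_pi(N.X); but then the left-hand side is
    phi_pi(M.(N.X)) = phi_pi((MN).X), because the quasi-meet is associative and
    orders the pairs (m_k, i_k) lexicographically, exactly as the numbers
    (m_k - 1) N_(pi(k)) + i_k ([sum_qmeet_okernel_mul]).  Substituting M_j N_j for M_j
    multiplies the coefficient of M_1 ... M_p by N_1 ... N_p, and the values of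
    a polynomial at positive integers determine its coefficients
    ([multilinear_coef_unique]), so the two descriptions of phi_pi(M.(N.X))
    give K_pi(N.X) = N_1 ... N_p K_pi(X). *)

(** * The coefficient of the product of all the variables *)

Section MultilinearCoefficient.
Variables (K : numFieldType) (V : lmodType K) (p : nat).
Implicit Types (G : ('I_p -> nat) -> V) (C : V).

(** Polynomials are handled through their values at positive integers; the
    shape is that of [is_cumulant], which is an instance by conversion. *)
Definition multilinear_coef G C : Prop :=
  exists (d : nat) (c : {ffun 'I_p -> 'I_d.+2} -> V),
    (forall N : 'I_p -> nat, (forall j, 0 < N j)%N ->
       G N = \sum_a c a *+ (\prod_j N j ^ a j)%N) /\
    C = c [ffun=> inord 1].

(** In degree less than D, the linear coefficient is a linear combination of
    the values at 1, ..., D, because Vandermonde matrices on distinct nodes are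
    invertible. *)
Lemma linear_coef_weights D : exists w : 'I_D -> K,
  forall a, (a < D)%N -> \sum_(v < D) w v * v.+1%:R ^+ a = (a == 1%N)%:R.
Proof.
pose x : 'rV[K]_D := \row_v v.+1%:R; pose W := Vandermonde D x.
have uW : W \in unitmx.
  rewrite unitmxE det_Vandermonde unitfE; apply/prodf_neq0 => u _.
  apply/prodf_neq0 => v uv; rewrite !mxE subr_eq0 eqr_nat eqSS.
  by rewrite neq_ltn uv orbT.
pose e : 'cV[K]_D := \col_a ((a : nat) == 1%N)%:R.
exists (fun v => (invmx W *m e) v 0) => a aD.
have /matrixP/(_ (Ordinal aD) 0) := mulKVmx uW e.
rewrite [RHS]mxE /= => <-; rewrite mxE; apply: eq_bigr => v _.
by rewrite !mxE mulrC.
Qed.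

(** Applying the weights of [linear_coef_weights] in every variable recovers
    the coefficient from the values of G alone.  The weights depend on G only
    through a degree bound, so a common bound serves two representations. *)
Lemma multilinear_coef_unique G C C' :
  multilinear_coef G C -> multilinear_coef G C' -> C = C'.
Proof.
suff H D w : (forall a, (a < D)%N ->
    \sum_(v < D) w v * v.+1%:R ^+ a = (a == 1%N)%:R) ->
  forall d (c : {ffun 'I_p -> 'I_d.+2} -> V), (d.+2 <= D)%N ->
    (forall N : 'I_p -> nat, (forall j, 0 < N j)%N ->
       G N = \sum_a c a *+ (\prod_j N j ^ a j)%N) ->
  c [ffun=> inord 1] = \sum_(v : {ffun 'I_p -> 'I_D})
    (\prod_j w (v j)) *: G (fun j => (v j).+1).
  move=> [d [c [cG ->]]] [d' [c' [c'G ->]]].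
  have [w wP] := linear_coef_weights (maxn d d').+2.
  by rewrite (H _ _ wP) ?(H _ _ wP) ?ltnS ?leq_maxl ?leq_maxr.
move=> wP d c dD cG.
under eq_bigr => v _ do rewrite cG // scaler_sumr.
rewrite exchange_big /= (bigD1 [ffun=> inord 1]) //= [X in _ + X]big1 ?addr0.
  under eq_bigr => v _.
    rewrite -[c _ *+ _]scaler_nat scalerA natr_prod -big_split /=.
    under eq_bigr => j _ do rewrite ffunE natrX.
    over.
  rewrite -scaler_suml.
  rewrite -(bigA_distr_bigA (fun j (v : 'I_D) =>
    w v * v.+1%:R ^+ (inord 1 : 'I_d.+2))) /=.
  rewrite big1 ?scale1r // => j _.
  by rewrite wP ?inordK // (leq_trans _ dD).
(* Every other exponent differs from 1 in some variable, whose weighted sum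
   vanishes. *)
move=> a a1.
under eq_bigr => v _.
  rewrite -[c _ *+ _]scaler_nat scalerA natr_prod -big_split /=.
  under eq_bigr => j _ do rewrite natrX.
  over.
rewrite -scaler_suml.
rewrite -(bigA_distr_bigA (fun j (v : 'I_D) => w v * v.+1%:R ^+ a j)) /=.
suff [j aj] : exists j, a j != 1%N :> nat.
  rewrite (bigD1 j) //= wP ?(negPf aj) ?mul0r ?scale0r //.
  by rewrite (leq_trans _ dD).
apply/existsP; apply: contraNT a1; rewrite negb_exists => /forallP aj.
apply/eqP/ffunP => j; rewrite ffunE; apply/val_inj.
by rewrite /= inordK //; apply/eqP; rewrite -[_ == _]negbK aj.
Qed.

Lemma multilinear_coef_scale G C (L : 'I_p -> nat) :
  (forall j, 0 < L j)%N -> multilinear_coef G C ->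
  multilinear_coef (fun N => G (fun j => N j * L j)%N) (C *+ \prod_j L j).
Proof.
move=> L0 [d [c [cG ->]]].
exists d, (fun a => c a *+ (\prod_j L j ^ a j)%N); split=> [N N0|].
  rewrite cG => [|j]; last by rewrite muln_gt0 N0 L0.
  apply: eq_bigr => a _; rewrite -mulrnA; congr (_ *+ _).
  by rewrite -big_split; apply: eq_bigr => j _; rewrite expnMn mulnC.
by congr (_ *+ _); apply: eq_bigr => j _; rewrite ffunE inordK.
Qed.

(** C(x, t) as a polynomial in x. *)
Definition binomial_poly t : {poly K} :=
  t`!%:R^-1 *: \prod_(i < t) ('X - i%:R%:P).

Lemma horner_binomial_poly t N : (binomial_poly t).[N%:R] = 'C(N, t)%:R.
Proof.
rewrite /binomial_poly hornerZ horner_prod.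
have -> : \prod_(i < t) ('X - i%:R%:P).[N%:R] = (N ^_ t)%:R :> K.
  elim: t => [|t IH]; first by rewrite big_ord0.
  rewrite big_ord_recr /= IH ffactnSr natrM hornerXsubC.
  by case: (leqP t N) => [/natrB ->|Nt] //; rewrite ffact_small // !mul0r.
by rewrite -bin_ffact natrM mulrC mulfK // pnatr_eq0 -lt0n fact_gt0.
Qed.

Lemma size_binomial_poly t : (size (binomial_poly t) <= t.+1)%N.
Proof.
by rewrite (leq_trans (size_scale_leq _ _)) // size_prod_XsubC /index_enum
  -enumT size_enum_ord.
Qed.

(** Dividing t! C(x, t) = x (x - 1) ... (x - t + 1) by x and setting x = 0
    leaves (-1)^(t-1) (t-1)!. *)
Lemma binomial_poly_coef1 t : (0 < t)%N ->
  (binomial_poly t)`_1 = (-1) ^+ t.-1 / t%:R.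
Proof.
case: t => // t _; rewrite /binomial_poly coefZ big_ord_recl subr0 coefXM /=.
rewrite -horner_coef0 horner_prod.
under eq_bigr => i _ do rewrite hornerXsubC sub0r.
rewrite prodrN card_ord -natr_prod.
have -> : (\prod_(i < t) bump 0 i = t`!)%N.
  by rewrite fact_prod big_add1 big_mkord; apply: eq_bigr.
by rewrite factS natrM invfM mulrCA -mulrA mulVf ?mulr1 // pnatr_eq0 -lt0n
  fact_gt0.
Qed.

(** The source of the signs and denominators of mu~. *)
Lemma multilinear_coef_binomial (I : finType) (P : pred I)
    (t : I -> 'I_p -> nat) (F : I -> V) G :
  (forall i j, P i -> 0 < t i j)%N ->
  (forall N : 'I_p -> nat, (forall j, 0 < N j)%N ->
     G N = \sum_(i | P i) F i *+ (\prod_j 'C(N j, t i j))%N) ->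
  multilinear_coef G
    (\sum_(i | P i) (\prod_j ((-1) ^+ (t i j).-1 / (t i j)%:R)) *: F i).
Proof.
move=> t0 GE; pose d := (\max_(ij : I * 'I_p) t ij.1 ij.2)%N.
have td i j : (t i j <= d)%N by apply: (leq_bigmax (i, j)).
exists d, (fun a : {ffun 'I_p -> 'I_d.+2} => \sum_(i | P i)
  (\prod_j (binomial_poly (t i j))`_(a j)) *: F i); split; last first.
  apply: eq_bigr => i Pi; congr (_ *: _); apply: eq_bigr => j _.
  by rewrite ffunE inordK // binomial_poly_coef1 ?t0.
move=> N N0; rewrite GE //.
under [RHS]eq_bigr => a _ do rewrite -sumrMnl.
rewrite exchange_big; apply: eq_bigr => i _ /=.
rewrite -scaler_nat natr_prod.
have binE j : 'C(N j, t i j)%:R =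
    \sum_(a < d.+2) (binomial_poly (t i j))`_a * (N j)%:R ^+ a.
  rewrite -horner_binomial_poly; apply: horner_coef_wide.
  by rewrite (leq_trans (size_binomial_poly _)) // ltnS (leq_trans (td i j)).
rewrite (eq_bigr _ (fun j _ => binE j)) bigA_distr_bigA scaler_suml.
apply: eq_bigr => a _.
rewrite big_split /= mulrC -scalerA -scaler_nat natr_prod; congr (_ *: _).
by apply: eq_bigr => j _; rewrite natrX.
Qed.

End MultilinearCoefficient.

(** * Ordered set partitions as total preorders *)

Section OspOrder.
Variable n : nat.
Implicit Types (pi sigma tau : osp n) (k l : 'I_n).

Lemma mem_block pi k : k \in nth set0 pi (block_index pi k).
Proof. by rewrite -block_indexE //= block_index_subproof. Qed.

Lemma block_nonempty pi (j : nat) : (j < size pi)%N ->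
  exists k, block_index pi k = j :> nat.
Proof.
move=> jp; have /is_ospP[p0 _ _] := ospP pi.
have /set0Pn[k kj] : nth set0 pi j != set0.
  by apply: contraNneq p0 => <-; apply: mem_nth.
by exists k; apply/eqP; rewrite block_indexE.
Qed.

Lemma okernel_eq (u v : 'I_n -> nat) :
  (forall k l, (u k < u l)%N = (v k < v l)%N) -> okernel u = okernel v.
Proof.
move=> uv; have uvE k l : (u k == u l) = (v k == v l).
  by have := uv k l; have := uv l k; lia.
pose h x := if [pick k | u k == x] is Some k then v k else 0%N.
have hu k : h (u k) = v k.
  rewrite /h; case: pickP => [l|/(_ k)]; last by rewrite eqxx.
  by rewrite uvE => /eqP.
apply: osp_inj; rewrite /= /okernel_seq.
have srt w : sorted ltn (sort leq (undup (codom w) : seq nat)).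
  by rewrite ltn_sorted_uniq_leq sort_uniq undup_uniq (sort_sorted leq_total).
have memw (w : 'I_n -> nat) x :
    (x \in sort leq (undup (codom w))) = (x \in codom w).
  by rewrite mem_sort mem_undup.
have -> : sort leq (undup (codom v)) = map h (sort leq (undup (codom u))).
  apply: (irr_sorted_eq ltn_trans ltnn) => //.
    apply: (@homo_sorted_in _ _ (mem (codom u)) h ltn ltn) => //.
      by move=> _ _ /codomP[k ->] /codomP[l ->] /=; rewrite !hu uv.
    by apply/allP => x; rewrite memw.
  move=> x; rewrite memw; apply/codomP/mapP => [[k ->]|[y]].
    by exists (u k); rewrite ?hu // memw codom_f.
  by rewrite memw => /codomP[k ->] ->; exists k; rewrite hu.
rewrite -map_comp; apply/eq_in_map => x; rewrite memw => /codomP[k ->] /=.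
by apply/setP => l; rewrite !inE hu uvE.
Qed.

(** The blocks are the classes of the preorder of block indices, so this strict
    order determines the ordered set partition. *)
Lemma osp_ext pi sigma :
  (forall k l, (block_index pi k < block_index pi l)%N
             = (block_index sigma k < block_index sigma l)%N) -> pi = sigma.
Proof.
move=> H; rewrite -(okernel_block_index pi) -(okernel_block_index sigma).
by apply: okernel_eq => k l; rewrite !ltnS H.
Qed.

Lemma block_index_okernel_lt (u : 'I_n -> nat) k l :
  (block_index (okernel u) k < block_index (okernel u) l)%N = (u k < u l)%N.
Proof.
rewrite !block_index_okernel; set s := sort _ _.
have us m : u m \in s by rewrite mem_sort mem_undup codom_f.
have srt : sorted leq s by apply: (sort_sorted leq_total).
apply/idP/idP; last first.
  rewrite !ltnNge; apply: contra => lk.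
  have := sorted_leq_nth leq_trans leqnn 0%N srt.
  move/(_ (index (u l) s) (index (u k) s)); rewrite !inE !index_mem !us.
  by move=> /(_ isT isT lk); rewrite !nth_index.
move=> lt; have := sorted_leq_nth leq_trans leqnn 0%N srt.
move/(_ (index (u k) s) (index (u l) s)); rewrite !inE !index_mem !us.
move=> /(_ isT isT (ltnW lt)); rewrite !nth_index // leq_eqVlt.
by case/orP=> // /eqP e; rewrite e ltnn in lt.
Qed.

Lemma osp_level_sets pi :
  pi = [seq [set k | block_index pi k == a :> nat] | a <- iota 0 (size pi)]
    :> seq {set 'I_n}.
Proof.
apply: (@eq_from_nth _ set0); rewrite ?size_map ?size_iota // => j jp.
rewrite (nth_map 0%N) ?size_iota // nth_iota // add0n.
by apply/setP => k; rewrite inE block_indexE.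
Qed.

Lemma iota_mul p s :
  iota 0 (p * s) = [seq (a * s + b)%N | a <- iota 0 p, b <- iota 0 s].
Proof.
elim: p => // p IH.
rewrite mulSnr iotaD IH -[p.+1]addn1 iotaD allpairs_cat /= cats0.
congr (_ ++ _).
by rewrite add0n -[X in iota X]addn0 iotaDl.
Qed.

Lemma ltn_lex a b c d s : (b < s)%N -> (d < s)%N ->
  (a * s + b < c * s + d)%N = (a < c)%N || (a == c) && (b < d)%N.
Proof.
move=> bs ds; case: (ltngtP a c) => [ac|ca|->] /=; last by rewrite ltn_add2l.
  apply: (@leq_trans (a.+1 * s)); first by rewrite mulSnr ltn_add2l.
  by rewrite (leq_trans _ (leq_addr _ _)) // leq_mul2r ac orbT.
apply/negbTE; rewrite -leqNgt (@leq_trans (c.+1 * s)) //.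
  by rewrite mulSnr leq_add2l ltnW.
by rewrite (leq_trans _ (leq_addr _ _)) // leq_mul2r ca orbT.
Qed.

(** The intersections of blocks are listed in lexicographic order, which is the
    numerical order of the pairs of block indices read as two-digit numbers;
    discarding empty intersections discards the numbers that are not taken. *)
Lemma qmeetE pi sigma : qmeet pi sigma =
  okernel (fun k => block_index pi k * size sigma + block_index sigma k)%N.
Proof.
apply: osp_inj; rewrite /= /qmeet_seq /okernel_seq; set u := fun k => _.
pose g v := [set k | u k == v].
have s0 k : (0 < size sigma)%N.
  by apply: leq_ltn_trans (ltn_ord (block_index sigma k)).
have -> : [seq P :&: Q | P <- pi, Q <- sigma] =
    map g (iota 0 (size pi * size sigma)).
  rewrite {1}(osp_level_sets pi) {1}(osp_level_sets sigma) iota_mul.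
  rewrite map_allpairs allpairs_mapl allpairs_mapr.
  apply/eq_in_allpairs => a b _; rewrite mem_iota => bs /=.
  apply/setP => k; rewrite !inE; apply/andP/eqP => [[/eqP <- /eqP <- //]|].
  have sk : (block_index sigma k < size sigma)%N by exact: block_index_subproof.
  rewrite /u => e; have := congr1 (divn^~ (size sigma)) e.
  rewrite !divnMDl ?s0 // !divn_small // !addn0 => ->; rewrite eqxx.
  have := congr1 (modn^~ (size sigma)) e.
  by rewrite !modnMDl !modn_small // => ->; rewrite eqxx.
rewrite filter_map; congr map.
apply: (irr_sorted_eq ltn_trans ltnn).
- by apply: sorted_filter; [exact: ltn_trans|exact: iota_ltn_sorted].
- by rewrite ltn_sorted_uniq_leq sort_uniq undup_uniq (sort_sorted leq_total).
move=> x; rewrite mem_filter mem_iota mem_sort mem_undup /= add0n.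
apply/andP/codomP => [[/set0Pn[k]]|[k ->]].
  by rewrite inE => /eqP <- _; exists k.
split; first by apply/set0Pn; exists k; rewrite inE.
rewrite /u; apply: (@leq_trans ((block_index pi k).+1 * size sigma)).
  by rewrite mulSnr ltn_add2l; exact: block_index_subproof.
by rewrite leq_mul2r; apply/orP; right; exact: block_index_subproof.
Qed.

Lemma block_index_qmeet_lt pi sigma k l :
  (block_index (qmeet pi sigma) k < block_index (qmeet pi sigma) l)%N =
  (block_index pi k < block_index pi l)%N ||
  (block_index pi k == block_index pi l) &&
  (block_index sigma k < block_index sigma l)%N.
Proof.
rewrite qmeetE block_index_okernel_lt ltn_lex //; exact: block_index_subproof.
Qed.

Lemma block_index_qmeet_eq pi sigma k l :
  (block_index (qmeet pi sigma) k == block_index (qmeet pi sigma) l) =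
  (block_index pi k == block_index pi l) &&
  (block_index sigma k == block_index sigma l).
Proof.
have := block_index_qmeet_lt pi sigma k l.
have := block_index_qmeet_lt pi sigma l k.
rewrite -!(inj_eq val_inj) /=; lia.
Qed.

(** In terms of preorders, tau <= pi says that tau extends the strict order of
    pi.  Contrapositively, the case of a tie in tau is refinement, and the case
    of a strict inequality in tau is the order condition on blocks. *)
Lemma osp_leP tau pi :
  reflect (forall k l, (block_index pi k < block_index pi l)%N ->
             (block_index tau k < block_index tau l)%N) (osp_le tau pi).
Proof.
have nonempty (s : osp n) Q : Q \in (s : seq _) -> exists k, k \in Q.
  move=> Qs; apply/set0Pn; apply: contraTneq Qs => ->.
  by have /is_ospP[] := ospP s.
apply: (iffP andP) => [[ref ord] k l kl|H].
  have sub m : nth set0 tau (block_index tau m) \subset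
               nth set0 pi (block_index pi m).
    have /forallP/(_ (nth set0 tau (block_index tau m))) := ref.
    rewrite inE mem_nth ?block_index_subproof //= => /existsP[P /andP[]].
    rewrite inE => /(nthP set0)[j jp <-] /subsetP sub.
    have := sub m (mem_block tau m); rewrite -block_indexE // => /eqP e.
    by apply/subsetP => x /sub; rewrite -e.
  case: (ltngtP (block_index tau k) (block_index tau l)) => // [lk|e].
    move/forallP/(_ (block_index tau l))/forallP/(_ (block_index tau k)): ord.
    move/forallP/(_ (block_index pi l))/forallP/(_ (block_index pi k)).
    by rewrite lk !sub /= leqNgt kl.
  have /subsetP/(_ k) := sub l; rewrite -e => /(_ (mem_block tau k)).
  rewrite -block_indexE ?block_index_subproof // => /eqP e'.
  by rewrite e' ltnn in kl.
split.
  apply/forallP => Q; apply/implyP; rewrite inE => Qt.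
  have [k kQ] := nonempty _ _ Qt.
  apply/existsP; exists (nth set0 pi (block_index pi k)).
  rewrite inE mem_nth ?block_index_subproof //=; apply/subsetP => l.
  move: Qt kQ => /(nthP set0)[j jt <-].
  rewrite -!block_indexE ?block_index_subproof //.
  move=> /eqP kj /eqP lj; apply/eqP.
  case: (ltngtP (block_index pi l) (block_index pi k)) => // /H.
    by rewrite kj lj ltnn.
  by rewrite kj lj ltnn.
apply/'forall_'forall_'forall_'forall_implyP => i j a b /and3P[ij ia jb].
have [k kE] := block_nonempty (ltn_ord i).
have [l lE] := block_nonempty (ltn_ord j).
have ka : block_index pi k = a :> nat.
  by apply/eqP; rewrite block_indexE // (subsetP ia) // -block_indexE // kE.
have lb : block_index pi l = b :> nat.
  by apply/eqP; rewrite block_indexE // (subsetP jb) // -block_indexE // lE.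
rewrite -ka -lb leqNgt; apply/negP => /H; rewrite kE lE.
by rewrite ltnNge ltnW.
Qed.

Lemma qmeet_le pi sigma : osp_le (qmeet pi sigma) pi.
Proof. by apply/osp_leP => k l kl; rewrite block_index_qmeet_lt kl. Qed.

(** Between different blocks of pi, both sides are ordered as in pi; only the
    comparisons inside the blocks of pi constrain m. *)
Lemma qmeet_okernelP tau pi (m : 'I_n -> nat) : osp_le tau pi ->
  reflect (forall k l, block_index pi k = block_index pi l ->
             (m k < m l)%N = (block_index tau k < block_index tau l)%N)
    (qmeet pi (okernel m) == tau).
Proof.
move=> /osp_leP tp; apply: (iffP eqP) => [<- k l kl|H].
  by rewrite block_index_qmeet_lt block_index_okernel_lt kl ltnn eqxx.
apply: osp_ext => k l; rewrite block_index_qmeet_lt block_index_okernel_lt.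
case: (ltngtP (block_index pi k) (block_index pi l)) =>
    [/[dup] /tp -> //|lk|/val_inj kl].
  rewrite -(inj_eq val_inj) gtn_eqF //=; apply/esym/negbTE.
  by rewrite -leqNgt ltnW ?tp.
by rewrite kl eqxx H.
Qed.

(** Both sides order positions lexicographically by (pi, m, i).  The numbers
    m_k N_k + i_k are compared only for k in one block of pi, so it is enough
    that N be constant there. *)
Lemma qmeet_okernel_lex pi (N m i : 'I_n -> nat) :
  (forall k l, block_index pi k = block_index pi l -> N k = N l) ->
  (forall k, i k < N k)%N ->
  qmeet (qmeet pi (okernel m)) (okernel i) =
  qmeet pi (okernel (fun k => m k * N k + i k)%N).
Proof.
move=> piN iN; apply: osp_ext => k l.
rewrite !block_index_qmeet_lt block_index_qmeet_eq !block_index_okernel_lt.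
have -> : (block_index (okernel m) k == block_index (okernel m) l) =
    (m k == m l).
  rewrite -(inj_eq val_inj) /= !eqn_leq.
  have := block_index_okernel_lt m k l; have := block_index_okernel_lt m l k.
  by rewrite /=; lia.
case: eqP => [/[dup] kl /piN Nkl|_]; last by rewrite !andFb !orbF.
rewrite kl ltnn /= Nkl ltn_lex ?iN // -Nkl; exact: iN.
Qed.

Lemma okernelS (u : 'I_n -> nat) : okernel (fun k => (u k).+1) = okernel u.
Proof. exact: okernel_eq. Qed.

End OspOrder.

(** * Counting fillings that respect given ranks *)

Section IncreasingFillings.

Lemma index_filter_lt (T : eqType) (a : pred T) (s : seq T) x y :
  a x -> a y ->
  (index x (filter a s) < index y (filter a s))%N = (index x s < index y s)%N.
Proof.
move=> ax ay; elim: s => //= z s IH; case: ifP => az /=.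
  by case: eqP; case: eqP => // _ _; rewrite ltnS IH.
have [zx|_] := eqVneq z x; first by rewrite zx ax in az.
by have [zy|_] := eqVneq z y; [rewrite zy ay in az|rewrite ltnS IH].
Qed.

Lemma sorted_tnth_lt t M (w : t.-tuple 'I_M) (x y : 'I_t) :
  sorted ltn [seq val i | i <- w] -> (tnth w x < tnth w y)%N = (x < y)%N.
Proof.
move=> srt.
have mono (a b : 'I_t) : (a < b)%N -> (tnth w a < tnth w b)%N.
  move=> ab; have := sorted_ltn_nth ltn_trans 0%N srt.
  move/(_ a b); rewrite !inE size_map size_tuple !ltn_ord => /(_ isT isT ab).
  have d := tnth w a.
  by rewrite !(nth_map d) ?size_tuple // -!tnth_nth.
case: (ltngtP x y) => [/mono //|/mono yx|/val_inj ->]; last by rewrite ltnn.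
by apply/negbTE; rewrite -leqNgt ltnW.
Qed.

Variables (I : finType) (p : nat) (f : I -> 'I_p) (t M : 'I_p -> nat).
Variable r : forall k, 'I_(t (f k)).
Hypothesis r_surj : forall j (x : 'I_(t j)),
  exists k, f k = j /\ r k = x :> nat.

(** Inside the class of f over j, a filling m ordered like the ranks r is the
    same as the increasing sequence of its t_j values, of which there are
    C(M_j, t_j); surjectivity of the ranks ensures that no value is skipped. *)
Lemma card_increasing_fillings :
  #|[set m : {dffun forall k : I, 'I_(M (f k))} |
      [forall k, forall l, (f k == f l) ==> ((m k < m l)%N == (r k < r l)%N)]]|
  = (\prod_j 'C(M j, t j))%N.
Proof.
pose T j : finType :=
  {w : (t j).-tuple 'I_(M j) | sorted ltn [seq val i | i <- w]}.
have -> : (\prod_j 'C(M j, t j))%N = #|{dffun forall j, T j}|.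
  rewrite card_dep_ffun foldrE big_map big_enum; apply: eq_bigr => j _.
  by rewrite -card_ltn_sorted_tuples cardsE card_sig.
pose h (w : {dffun forall j, T j}) : {dffun forall k : I, 'I_(M (f k))} :=
  [ffun k => tnth (val (w (f k))) (r k)].
have h_inj : injective h.
  move=> w w' /ffunP e; apply/ffunP => j; apply/val_inj/eq_from_tnth => x.
  have [k [fk rk]] := r_surj x; case: j / fk x rk => x /val_inj <-.
  by have := e k; rewrite !ffunE.
rewrite -(card_imset _ h_inj); congr #|pred_of_set _|.
apply/setP => m; rewrite inE; apply/idP/imsetP => [mP|[w _ ->]]; last first.
  have wlt i j (a : 'I_(t i)) (b : 'I_(t j)) : i = j ->
      (tnth (val (w i)) a < tnth (val (w j)) b)%N = (a < b)%N.
    by move=> e; case: j / e b => b; rewrite sorted_tnth_lt ?(valP (w i)).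
  by apply/'forall_'forall_implyP => k l /eqP kl; rewrite !ffunE wlt.
have {}mP k l : f k = f l -> (m k < m l)%N = (r k < r l)%N.
  move=> /eqP kl.
  by have /'forall_'forall_implyP/(_ k l kl)/eqP := mP.
have rep j (x : 'I_(t j)) : {k | (f k == j) && (r k == x :> nat)}.
  apply: sigW; have [k [fk rk]] := r_surj x; exists k.
  by apply/andP; split; apply/eqP.
have rep_lt j x : (m (sval (rep j x)) < M j)%N.
  case: (rep j x) => k /= /andP[/eqP kj _].
  by case: j / kj x => x; exact: ltn_ord.
pose v j x : 'I_(M j) := Ordinal (rep_lt j x).
have vE k : v (f k) (r k) = m k.
  apply/val_inj => /=; case: (rep _ _) => l /= /andP[/eqP lk /eqP rlk].
  by case: (ltngtP (m l) (m k)) => //; rewrite mP // rlk ltnn.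
have v_sorted j : sorted ltn [seq val i | i <- [tuple v j x | x < t j]].
  rewrite -map_comp; apply: (@homo_sorted _ _ _ (relpre val ltn)).
    move=> x y /=; case: (rep _ _) => k /= /andP[/eqP kj /eqP rk].
    case: (rep _ _) => l /= /andP[/eqP lj /eqP rl].
    by rewrite mP ?kj ?lj // rk rl.
  by rewrite -sorted_map val_enum_ord iota_ltn_sorted.
exists [ffun j => (exist _ [tuple v j x | x < t j] (v_sorted j) : T j)] => //.
by apply/ffunP => k; rewrite !ffunE tnth_mktuple vE.
Qed.

End IncreasingFillings.

(** * Sums over index tuples *)

Section Counting.
Variable n : nat.
Implicit Types (pi tau : osp n).

Definition block_count tau pi (j : 'I_(size pi)) : nat :=
  nblocks_in tau (nth set0 pi j).

Lemma uniq_osp tau : uniq tau.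
Proof.
have /is_ospP[t0 _ td] := ospP tau.
rewrite uniq_pairwise; apply/(pairwiseP set0) => i j.
rewrite !inE => it jt ij /=.
apply/eqP => e; have [k kj] := block_nonempty jt.
move/eqP: kj; rewrite block_indexE // => kj.
by apply: (td k i j) => //; [rewrite ij | rewrite e].
Qed.

Lemma sub_block tau pi : osp_le tau pi -> forall k (j : 'I_(size pi)),
  (nth set0 tau (block_index tau k) \subset nth set0 pi j) =
  (block_index pi k == j).
Proof.
move=> /osp_leP le k j; apply/subsetP/eqP => [/(_ k (mem_block tau k))|<- l].
  by rewrite -block_indexE // => /eqP/val_inj.
rewrite -!block_indexE ?block_index_subproof // => /eqP lk.
by case: (ltngtP (block_index pi l) _) => // /le; rewrite lk ltnn.
Qed.

(** The rank of k is the position of its tau-block among the tau-blocks lying in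
    the pi-block of k; it numbers these consecutively from 0. *)
Lemma block_rank tau pi : osp_le tau pi ->
  exists r : forall k, 'I_(block_count tau (block_index pi k)),
    (forall k l, block_index pi k = block_index pi l ->
       (r k < r l)%N = (block_index tau k < block_index tau l)%N) /\
    (forall j (x : 'I_(block_count tau j)), exists k,
       block_index pi k = j /\ r k = x :> nat).
Proof.
move=> le; have sub := sub_block le.
pose inner (j : 'I_(size pi)) := 
    [seq Q : {set 'I_n} <- tau | Q \subset nth set0 pi j].
pose own k := nth set0 tau (block_index tau k).
have own_inner k : own k \in inner (block_index pi k).
  by rewrite mem_filter sub eqxx mem_nth ?block_index_subproof.
have r_lt k : (index (own k) (inner (block_index pi k)) <
               block_count tau (block_index pi k))%N.
  by rewrite /block_count /nblocks_in -size_filter index_mem own_inner.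
exists (fun k => Ordinal (r_lt k)); split=> [k l kl|j x] /=.
  rewrite kl index_filter_lt ?sub ?kl //.
  by rewrite /own !index_uniq ?uniq_osp ?block_index_subproof.
have xj : (x < size (inner j))%N by rewrite size_filter; exact: ltn_ord.
have := mem_nth set0 xj; rewrite mem_filter => /andP[Qj /(nthP set0)[i it Qi]].
have [k kE] := block_nonempty it.
have ownk : own k = nth set0 (inner j) x by rewrite /own kE Qi.
have kj : block_index pi k = j by apply/eqP; rewrite -sub -/(own k) ownk.
exists k; split=> //.
by rewrite kj ownk index_uniq // filter_uniq ?uniq_osp.
Qed.

Lemma card_qmeet_okernel tau pi (M : 'I_(size pi) -> nat) : osp_le tau pi ->
  #|[set m : {dffun forall k : 'I_n, 'I_(M (block_index pi k))} |
      qmeet pi (okernel (fun k => (m k).+1)) == tau]|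
  = (\prod_j 'C(M j, block_count tau j))%N.
Proof.
move=> le; have [r [r_lt r_surj]] := block_rank le.
rewrite -(card_increasing_fillings M r_surj).
apply: eq_card => m; rewrite !inE.
apply/(qmeet_okernelP _ le)/'forall_'forall_implyP.
  by move=> H k l /eqP kl; rewrite r_lt // -H // ltnS.
by move=> H k l kl; have /eqP := H k l (introT eqP kl); rewrite r_lt.
Qed.

Lemma sum_qmeet_okernel (V : nmodType) (F : osp n -> V) pi
    (M : 'I_(size pi) -> nat) :
  \sum_(m : {dffun forall k : 'I_n, 'I_(M (block_index pi k))})
     F (qmeet pi (okernel (fun k => (m k).+1))) =
  \sum_(tau | osp_le tau pi) F tau *+ (\prod_j 'C(M j, block_count tau j))%N.
Proof.
pose meet (m : {dffun forall k : 'I_n, 'I_(M (block_index pi k))}) :=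
  qmeet pi (okernel (fun k => (m k).+1)).
rewrite (partition_big meet (fun tau => osp_le tau pi)) /=; last first.
  by move=> m _; apply: qmeet_le.
apply: eq_bigr => tau le; rewrite -card_qmeet_okernel //.
rewrite (eq_bigr (fun=> F tau)) => [|m /eqP <- //].
by rewrite sumr_const; congr (_ *+ _); apply: eq_card => m; rewrite !inE.
Qed.

(** The double sum expresses M.(N.X) = (MN).X: the pair (m_k, i_k) is encoded,
    counting from 0, as m_k N + i_k with N = N_(pi(k)), a bijection by Euclidean
    division which preserves all quasi-meets by [qmeet_okernel_lex]. *)
Lemma sum_qmeet_okernel_mul (V : nmodType) (F : osp n -> V) pi
    (M N : 'I_(size pi) -> nat) :
  \sum_(m : {dffun forall k : 'I_n, 'I_(M (block_index pi k))})
    \sum_(i : {dffun forall k : 'I_n, 'I_(N (block_index pi k))})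
      F (qmeet (qmeet pi (okernel (fun k => (m k).+1)))
               (okernel (fun k => (i k).+1))) =
  \sum_(j : {dffun forall k : 'I_n,
               'I_(M (block_index pi k) * N (block_index pi k))})
    F (qmeet pi (okernel (fun k => (j k).+1))).
Proof.
pose b := block_index pi.
pose DM := {dffun forall k : 'I_n, 'I_(M (b k))}.
pose DN := {dffun forall k : 'I_n, 'I_(N (b k))}.
pose DMN := {dffun forall k : 'I_n, 'I_(M (b k) * N (b k))}.
have enc_lt (x : DM * DN) k : (x.1 k * N (b k) + x.2 k < M (b k) * N (b k))%N.
  apply: (@leq_trans ((x.1 k).+1 * N (b k))); first by rewrite mulSnr ltn_add2l.
  by rewrite leq_mul2r ltn_ord orbT.
have N0 (j : DMN) k : (0 < N (b k))%N.
  have := leq_ltn_trans (leq0n _) (ltn_ord (j k)).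
  by rewrite muln_gt0 => /andP[].
have quo_lt (j : DMN) k : (j k %/ N (b k) < M (b k))%N.
  by rewrite ltn_divLR ?(N0 j).
have rem_lt (j : DMN) k : (j k %% N (b k) < N (b k))%N.
  by rewrite ltn_mod (N0 j).
pose enc (x : DM * DN) : DMN := [ffun k => Ordinal (enc_lt x k)].
pose dec (j : DMN) : DM * DN :=
  ([ffun k => Ordinal (quo_lt j k)], [ffun k => Ordinal (rem_lt j k)]).
have enc_bij : bijective enc.
  exists dec => [[m i]|j].
    congr (_, _); apply/ffunP => k; apply/val_inj; rewrite !ffunE /= ffunE /=.
      rewrite divnMDl ?divn_small ?addn0 //.
      exact: leq_ltn_trans (ltn_ord (i k)).
    by rewrite modnMDl modn_small.
  by apply/ffunP => k; apply/val_inj; rewrite !ffunE /= !ffunE /= -divn_eq.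
rewrite pair_bigA [RHS](reindex enc) /=; last exact: onW_bij.
apply: eq_bigr => -[m i] _ /=; congr F; rewrite !okernelS.
rewrite (@qmeet_okernel_lex _ _ (N \o b)) //; last first.
  by rewrite /b => k l /= ->.
by congr (qmeet pi _); apply: okernel_eq => k l; rewrite !ffunE.
Qed.

Lemma block_count_gt0 tau pi (j : 'I_(size pi)) : osp_le tau pi ->
  (0 < block_count tau j)%N.
Proof.
move=> le; have [k kj] := block_nonempty (ltn_ord j).
rewrite -has_count; apply/hasP; exists (nth set0 tau (block_index tau k)).
  by rewrite mem_nth ?block_index_subproof.
by rewrite sub_block //; apply/eqP/val_inj.
Qed.

Lemma sum_block_count tau pi : osp_le tau pi ->
  (\sum_(j < size pi) block_count tau j)%N = size tau.
Proof.
move=> le; rewrite /block_count /nblocks_in.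
under eq_bigr => j _ do rewrite -sum1_count big_mkcond (big_nth set0) big_mkord.
rewrite exchange_big /= -[RHS]card_ord -sum1_card; apply: eq_bigr => i _.
have [k kE] := block_nonempty (ltn_ord i).
rewrite -kE -big_mkcond (eq_bigl (pred1 (block_index pi k))) ?big_pred1_eq //.
by move=> j; rewrite sub_block // eq_sym.
Qed.

(** The exponent |tau| - |pi| is the sum of the t_j - 1. *)
Lemma mu_tildeE (K : fieldType) tau pi : osp_le tau pi ->
  mu_tilde K tau pi =
  \prod_(j < size pi) ((-1) ^+ (block_count tau j).-1 / (block_count tau j)%:R).
Proof.
move=> le; rewrite /mu_tilde big_split prodfV (big_nth set0) big_mkord.
congr (_ / _).
rewrite -(sum_block_count le) -[X in (_ - X)%N]card_ord -sum1_card.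
rewrite -sumnB => [|j _]; last exact: block_count_gt0.
rewrite expr_sum; apply: eq_bigr => j _.
by rewrite subn1.
Qed.

End Counting.

(** * Extensivity of cumulants *)

Section Extensivity.
Variables (K : numFieldType) (A B : assocAlgType K) (phi : {linear A -> B}).
Variables (S : spreadability_system phi) (n : nat).
Implicit Types (pi tau : osp n) (X : 'I_n -> A) (C : B).

(** Stated for arbitrary F because it is applied both to phi_tau(X), giving
    K_pi(X), and to phi_tau(N.X), giving K_pi(N.X). *)
Lemma multilinear_coef_qmeet_okernel (F : osp n -> B) pi :
  multilinear_coef (fun M : 'I_(size pi) -> nat =>
    \sum_(m : {dffun forall k : 'I_n, 'I_(M (block_index pi k))})
       F (qmeet pi (okernel (fun k => (m k).+1))))
    (\sum_(tau | osp_le tau pi) mu_tilde K tau pi *: F tau).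
Proof.
rewrite (eq_bigr (fun tau => (\prod_(j < size pi)
  ((-1) ^+ (block_count tau j).-1 / (block_count tau j)%:R : K)) *: F tau)).
  apply: multilinear_coef_binomial => [tau j le|N _].
    exact: block_count_gt0.
  exact: sum_qmeet_okernel.
by move=> tau le; rewrite mu_tildeE.
Qed.

(** The polynomial of the definition of cumulants exists, so the choice made
    there does not fall back on its default value. *)
Lemma cumulantP pi X : is_cumulant S pi X (cumulant S pi X).
Proof.
apply: (classical_sets.xgetPex 0); eexists.
exact: (multilinear_coef_qmeet_okernel (fun sigma => phi_part S sigma X)).
Qed.

(** Both sides are the coefficient of M_1 ... M_p in phi_pi((MN).X). *)
Lemma cumulant_dot_block pi (N : 'I_(size pi) -> nat) X :
  (forall j, 0 < N j)%N ->
  cumulant_dot S pi (fun k => N (block_index pi k)) X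
  = cumulant S pi X *+ (\prod_j N j)%N.
Proof.
move=> N0; apply: (@multilinear_coef_unique K B); last first.
  exact: (multilinear_coef_scale N0 (cumulantP pi X)).
rewrite /cumulant_dot.
have [d [c [cE ->]]] := multilinear_coef_qmeet_okernel
  (fun sigma => phi_part_dot S sigma (fun k => N (block_index pi k)) X) pi.
exists d, c; split=> // M M0; rewrite -cE //.
exact: esym
  (sum_qmeet_okernel_mul (fun sigma => phi_part S sigma X) M N).
Qed.

End Extensivity.

Theorem proposition3p16 (R : realType) (A B : assocAlgType R[i])
    (phi : {linear A -> B}) (S : spreadability_system phi)
    (n : nat) (n_gt0 : (0 < n)%N) (pi : osp n) (X : 'I_n -> A) :
  (forall N : nat, (0 < N)%N ->
     cumulant_dot S pi (fun=> N) X = cumulant S pi X *+ (N ^ size pi)%N)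
  /\
  (forall N : 'I_(size pi) -> nat, (forall j, (0 < N j)%N) ->
     cumulant_dot S pi (fun k => N (block_index pi k)) X
       = cumulant S pi X *+ (\prod_j N j)%N).
Proof.
split=> N N0; last exact: cumulant_dot_block.
have := @cumulant_dot_block _ _ _ _ S n pi (fun=> N) X (fun=> N0).
by rewrite prod_nat_const card_ord.
Qed.
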